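(* Let $n \geq 4$ and let $\mathsf{Mif}(n) := \big(\mathrm{maj}(\sigma \tau^{-1}) + \mathrm{inv}(\sigma \tau^{-1}) + \mathrm{fix}(\sigma \tau^{-1})\big)_{\sigma, \tau \in \mathfrak{S}_n}$. Then $\mathsf{Mif}(n)$ is diagonalizable, and $$\mathrm{Sp}\big(\mathsf{Mif}(n)\big) = \Big\{n!\binom{n}{2}+n!,\ n(2-n)(n+5)\frac{(n-2)!}{6},\ -\frac{2\,n!}{3},\ n(n-2)!,\ 0 \Big\},$$ with multiplicities (1) $\mathrm{m}_{\mathsf{Mif}(n)}\big(n!\binom{n}{2}+n!\big) = 1$; (2) $\mathrm{m}_{\mathsf{Mif}(n)}\big(n(2-n)(n+5)\frac{(n-2)!}{6}\big) = n-1$; (3) $\mathrm{m}_{\mathsf{Mif}(n)}\big(-\frac{2\,n!}{3}\big) = \binom{n-1}{2}$; (4) $\mathrm{m}_{\mathsf{Mif}(n)}\big(n(n-2)!\big) = (n-1)(n-2)$; (5) $\mathrm{m}_{\mathsf{Mif}(n)}(0) = n! -\frac{n}{2}(3n-7) -3$.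
   Context: $[n]=\{1,\dots,n\}$ and $\mathfrak{S}_n$ is the symmetric group of $[n]$; products are compositions of maps. For $\sigma\in\mathfrak{S}_n$, $\mathrm{Des}\,\sigma := \{i\in[n-1]\mid \sigma(i)>\sigma(i+1)\}$, $\mathrm{maj}\,\sigma := \sum_{i\in\mathrm{Des}\,\sigma} i$ (major index), $\mathrm{inv}\,\sigma := \#\{(i,j)\in[n]^2 \mid i<j,\ \sigma(i)>\sigma(j)\}$, and $\mathrm{fix}\,\sigma := \#\{i\in[n]\mid \sigma(i)=i\}$. $\mathsf{Mif}(n)$ is a real $n!\times n!$ matrix with rows and columns indexed by $\mathfrak{S}_n$. $\mathrm{Sp}(\mathsf{M})$ is the set of eigenvalues of a square matrix $\mathsf{M}$ and $\mathrm{m}_{\mathsf{M}}(x)$ is the multiplicity of the eigenvalue $x$. *)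

(* Defs.v *)
From HB Require Import structures.
From mathcomp Require Import all_boot all_order all_fingroup all_algebra.
From mathcomp Require Import all_classical reals.

Set Implicit Arguments.
Unset Strict Implicit.
Unset Printing Implicit Defensive.

Import Order.TTheory GRing.Theory Num.Theory.

Local Open Scope ring_scope.

(* The ordinal [i : 'I_n] stands for the element [i.+1] of {1, ..., n}. *)

Definition Des (n : nat) (s : 'S_n) : {set 'I_n} :=
  [set i : 'I_n | [exists j : 'I_n, (j == i.+1 :> nat) && (s j < s i)%N]].

Definition maj (n : nat) (s : 'S_n) : nat := (\sum_(i in Des s) i.+1)%N.

Definition inv (n : nat) (s : 'S_n) : nat :=
  #|[set p : 'I_n * 'I_n | (p.1 < p.2)%N && (s p.2 < s p.1)%N]|.

Definition nfix (n : nat) (s : 'S_n) : nat := #|[set i : 'I_n | s i == i]|.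

(* [(s * t)%g] applies [s] first, so the composition of maps "sigma o tau^-1"
   is [(tau^-1 * sigma)%g].  Rows and columns are indexed by 'S_n through its
   canonical enumeration. *)
Definition Mif (R : realType) (n : nat) : 'M[R]_#|{: 'S_n}| :=
  \matrix_(i, j)
    let s : 'S_n := enum_val i in
    let t : 'S_n := enum_val j in
    let st : 'S_n := (t^-1 * s)%g in
    (maj st + inv st + nfix st)%N%:R.

Definition Sp (R : realType) (m : nat) (M : 'M[R]_m) : set R :=
  [set x | eigenvalue M x]%classic.

(* Algebraic multiplicity; it equals the dimension of the eigenspace when [M]
   is diagonalizable. *)
Definition mult (R : realType) (m : nat) (M : 'M[R]_m) (x : R) : nat :=
  mup x (char_poly M).

(* Main.v *)
(* Convolution by a function f on 'S_n maps F to s |-> sum_t f (t^-1 * s) F t.  For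
   f = maj + inv + fix, every f (t^-1 * s) is, as a function of s, a combination
   of 1, of the comparisons [s b < s a] and of the indicators [s a = x], so the
   rank is at most 1 + C(n, 2) + (n-1)(n-2).  On the other hand the convolution
   has the eigenvectors
     - 1;
     - sum_a c_a s(a), with sum c = 0;
     - sum_{a,b} c_ab [s a < s b], with c antisymmetric with zero row sums;
     - sum_a c_a phi(s a), with sum c = 0 and phi in the kernel of a linear form,
   and these families, together with the kernel, have dimensions at least equal
   to the stated multiplicities.  As those add up to n!, all the bounds are
   equalities and the eigenspaces span the whole space. *)

Require Import Defs.
From HB Require Import structures.
From mathcomp Require Import all_boot all_order all_fingroup all_algebra.
From mathcomp Require Import all_classical reals ring lra zify.

Set Implicit Arguments.
Unset Strict Implicit.
Unset Printing Implicit Defensive.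

Import Order.TTheory GRing.Theory Num.Theory.

Local Open Scope ring_scope.

(** * Diagonalizability from bounds on eigenspaces *)

Lemma char_poly_trmx (R : comNzRingType) n (A : 'M[R]_n) :
  char_poly A^T = char_poly A.
Proof.
rewrite /char_poly -[RHS]det_tr; congr (\det _).
by rewrite /char_poly_mx linearB /= tr_scalar_mx map_trmx.
Qed.

Lemma diagonalizable_trmx (F : fieldType) n (A : 'M[F]_n) :
  diagonalizable A^T -> diagonalizable A.
Proof.
move=> [P Pu /similar_diagPex [d /(similarLR Pu)]].
rewrite conjVmx // => dA; have Pu' : (invmx P)^T \in unitmx.
  by rewrite unitmx_tr unitmx_inv.
exists (invmx P)^T => //; apply/similar_diagPex; exists d.
apply/(similarLR Pu'); rewrite conjVmx // -trmx_inv invmxK.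
by rewrite -[A]trmxK dA !trmx_mul tr_diag_mx mulmxA.
Qed.

(** [P] conjugates [A] to [diag_mx d], so both have the same characteristic polynomial, and the rows
    of [P] at the indices with entry [a] are free eigenvectors for [a]. *)
Lemma diagonalizable_char_poly (F : fieldType) n (A : 'M[F]_n) :
  diagonalizable A ->
  exists2 d : 'rV[F]_n,
    char_poly A = \prod_i ('X - (d 0 i)%:P) &
    forall a, (#|[pred i | d 0%R i == a]| <= \rank (eigenspace A a))%N.
Proof.
move=> [P Pu /similar_diagPex [d /(similarLR Pu)]].
rewrite conjVmx // => dA; exists d => [|a].
  have ->: char_poly A = char_poly (diag_mx d).
    rewrite /char_poly /char_poly_mx dA !map_mxM /=.
    set Q := map_mx _ (invmx P); set P' := map_mx _ P.
    have QP : Q *m P' = 1%:M by rewrite -map_mxM mulVmx // map_mx1.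
    have -> : 'X%:M - Q *m map_mx polyC (diag_mx d) *m P' =
        Q *m ('X%:M - map_mx polyC (diag_mx d)) *m P'.
      by rewrite mulmxBr mulmxBl scalar_mxC -[X in _ = X - _]mulmxA QP mulmx1.
    by rewrite !det_mulmx mulrAC -det_mulmx QP det1 mul1r.
  rewrite char_poly_trig ?diag_mx_is_trig //.
  by apply: eq_bigr => i _; rewrite mxE eqxx mulr1n.
pose f (k : 'I_#|[pred i | d 0 i == a]|) := enum_val k.
have fr : row_free (rowsub f P).
  apply/row_freeP; exists (colsub f (invmx P)).
  rewrite -mxsub_mul mulmxV //.
  by apply/matrixP => i j; rewrite !mxE (inj_eq enum_val_inj).
rewrite -[X in (X <= _)%N](eqP fr); apply: mxrankS; apply/eigenspaceP.
have PA : P *m A = diag_mx d *m P by rewrite dA !mulmxA mulmxV // mul1mx.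
rewrite mul_rowsub_mx PA; apply/matrixP => i j; rewrite mxE mul_diag_mx !mxE.
by have := enum_valP i; rewrite inE => /eqP ->.
Qed.

(* The eigenspaces are in direct sum, so lower bounds on their dimensions that
   add up to the size of the matrix are all attained. *)
Lemma diagonalizable_of_rank_eigenspace (F : fieldType) n (A : 'M[F]_n)
    (I : finType) (l : I -> F) (d : I -> nat) :
  injective l -> (forall i, (d i <= \rank (eigenspace A (l i)))%N) ->
  (\sum_i d i)%N = n ->
  [/\ diagonalizable A, forall i, mup (l i) (char_poly A) = d i &
      forall a, eigenvalue A a -> exists i, a = l i].
Proof.
move=> linj ld dn.
have rs : \rank (\sum_i eigenspace A (l i))%MS =
    (\sum_i \rank (eigenspace A (l i)))%N.
  by apply/mxdirectP; apply: mxdirect_sum_eigenspace => i j _ _; apply: linj.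
have le1 : (\sum_i d i <= \sum_i \rank (eigenspace A (l i)))%N.
  by apply: leq_sum => i _; apply: ld.
have le2 : (\sum_i \rank (eigenspace A (l i)) <= n)%N by rewrite -rs rank_leq_row.
have full : row_full (\sum_i eigenspace A (l i))%MS.
  by rewrite /row_full rs eqn_leq le2 -{1}dn le1.
have dE i : \rank (eigenspace A (l i)) = d i.
  apply/esym/eqP; move: i.
  have := leqif_sum (P := predT) (fun i _ => leqif_eq (ld i)).
  case=> _; rewrite eqn_leq le1 {1}dn le2 /= => /esym /forallP dE i.
  exact: dE i.
have diagA : diagonalizable A.
  apply/diagonalizablePeigen; exists [seq l i | i <- enum I].
    by rewrite map_inj_uniq ?enum_uniq.
  by rewrite big_map big_enum /=; apply/eqmxP; rewrite submx1 sub1mx.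
have [D cD Drank] := diagonalizable_char_poly diagA.
have eigl a : eigenvalue A a -> exists i, a = l i.
  move=> ea.
  have [[i /eqP ->]|noi] := pselect (exists i, a == l i); first by exists i.
  (* An eigenvalue outside the list would add a nonzero summand to a direct sum that already has
     dimension [n]. *)
  suff : mxdirect (\sum_(o : unit + I) eigenspace A (if o is inr i then l i else a)).
    move/mxdirectP => /= rs'.
    have := rank_leq_row (\sum_(o : unit + I) eigenspace A (if o is inr i then l i else a))%MS.
    rewrite rs' big_sumType /= (big_pred1 tt) => [|[]//].
    rewrite -rs (eqP full) -[X in (_ <= X)%N]add0n leq_add2r leqn0.
    by rewrite mxrank_eq0 (negbTE ea).
  apply: mxdirect_sum_eigenspace => -[[]|i] [[]|j] _ _ //= e.
  - by case: noi; exists j; rewrite e.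
  - by case: noi; exists i; rewrite e.
  - by congr inr; apply: linj.
have cD' : char_poly A = \prod_(y <- [seq D 0 i | i <- enum 'I_n]) ('X - y%:P).
  by rewrite cD big_map big_enum.
have mupE a : mup a (char_poly A) = #|[pred i | D 0 i == a]|.
  by rewrite cD' mu_prod_XsubC count_map -size_filter cardE enumT.
split => // i; apply/eqP; move: i.
(* Both sides sum to [n], because every diagonal entry is an eigenvalue and hence some [l i]; so the
   inequalities are equalities. *)
have le3 i : (mup (l i) (char_poly A) <= d i)%N by rewrite mupE -dE.
have := leqif_sum (P := predT) (fun i _ => leqif_eq (le3 i)).
case=> _ /esym; rewrite dn => e; suff /eqP s : (\sum_i mup (l i) (char_poly A) = n)%N.
  by move: e; rewrite s => /forallP.
rewrite (eq_bigr _ (fun i _ => mupE (l i))).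
under eq_bigr do rewrite -sum1_card big_mkcond /=.
rewrite exchange_big /= -[RHS]card_ord -sum1_card; apply: eq_bigr => j _.
have [i Di] : exists i, D 0 j = l i.
  apply: eigl; rewrite eigenvalue_root_char cD' root_prod_XsubC.
  by rewrite map_f ?mem_enum.
rewrite (bigD1 i) //= inE Di eqxx big1 ?addn0 // => k ki.
by rewrite inE Di (inj_eq linj) eq_sym (negbTE ki).
Qed.

(** * Sums over permutations *)

Lemma sum_perm_image (R : nmodType) n (t : 'S_n) (G : 'I_n -> R) :
  \sum_a G (t a) = \sum_x G x.
Proof. by rewrite [RHS](reindex_inj (@perm_inj _ t)). Qed.

Lemma sum_perm_mull (R : nmodType) n (p : 'S_n) (F : 'S_n -> R) :
  \sum_t F (p * t)%g = \sum_t F t.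
Proof. by rewrite [RHS](reindex_inj (mulgI p)). Qed.

(** Composing with a transposition shows that the sum does not depend on [a]; summed over all
    positions, each permutation contributes [\sum_x G x]. *)
Lemma sum_perm_eval (R : numFieldType) k (a : 'I_k.+1) (G : 'I_k.+1 -> R) :
  \sum_(t : 'S_k.+1) G (t a) = k`!%:R * \sum_x G x.
Proof.
have ind b : \sum_(t : 'S_k.+1) G (t b) = \sum_(t : 'S_k.+1) G (t a).
  rewrite -(sum_perm_mull (tperm a b)); apply: eq_bigr => t _.
  by rewrite permM tpermR.
apply: (@mulfI R k.+1%:R); first by rewrite pnatr_eq0.
have : \sum_b \sum_(t : 'S_k.+1) G (t b) = k.+1`!%:R * \sum_x G x.
  rewrite exchange_big /= (eq_bigr _ (fun t _ => sum_perm_image t G)).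
  by rewrite sumr_const card_Sn mulr_natl.
rewrite (eq_bigr _ (fun b _ => ind b)) sumr_const card_ord => e; rewrite mulr_natl e.
by rewrite mulrA -natrM.
Qed.

(** The same averaging, over ordered pairs of distinct positions; [G x x = 0] allows the diagonal to
    be included on both sides. *)
Lemma sum_perm_eval2 (R : numFieldType) k (a b : 'I_k.+2)
    (G : 'I_k.+2 -> 'I_k.+2 -> R) :
  (forall x, G x x = 0) -> a != b ->
  \sum_(t : 'S_k.+2) G (t a) (t b) = k`!%:R * \sum_x \sum_y G x y.
Proof.
move=> G0 ab; pose S a b := \sum_(t : 'S_k.+2) G (t a) (t b).
have Sr c d e : d != c -> e != c -> S c d = S c e.
  move=> dc ec; rewrite /S -(sum_perm_mull (tperm d e)).
  by apply: eq_bigr => t _; rewrite !permM tpermL tpermD.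
have Sc c d : S c d = S d c.
  rewrite /S -(sum_perm_mull (tperm c d)).
  by apply: eq_bigr => t _; rewrite !permM tpermL tpermR.
have ind c d : c != d -> S c d = S a b.
  move=> cd; have [cb|cb] := eqVneq c b.
    by rewrite (Sc a b) cb; apply: Sr; rewrite // eq_sym -cb.
  rewrite (Sr c d b) 1?[_ == c]eq_sym //.
  by rewrite Sc [RHS]Sc; apply: Sr.
rewrite -/(S a b).
apply: (@mulfI R (k.+2 * k.+1)%:R); first by rewrite pnatr_eq0.
have : \sum_c \sum_d S c d = k.+2`!%:R * \sum_x \sum_y G x y.
  rewrite /S (eq_bigr _ (fun c _ => exchange_big _ _ _ _ _ _)) exchange_big /=.
  rewrite (eq_bigr (fun _ => \sum_x \sum_y G x y)); last first.
    move=> t _; rewrite -[RHS](sum_perm_image t); apply: eq_bigr => x _.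
    by rewrite (sum_perm_image t (G (t x))).
  by rewrite sumr_const card_Sn mulr_natl.
rewrite (eq_bigr (fun _ => S a b *+ k.+1)) => [|c _]; last first.
  rewrite (bigD1 c) //= {1}/S big1 ?add0r => [|t _]; last exact: G0.
  rewrite (eq_bigr (fun _ => S a b)) => [|d dc]; last by rewrite ind // eq_sym.
  by rewrite sumr_const cardC1 card_ord.
rewrite sumr_const card_ord => e; rewrite mulr_natl mulnC mulrnA e.
by rewrite mulrA -natrM 2!factS [(k.+1 * k.+2)%N]mulnC mulnA.
Qed.

(** All [k] positions other than [a] and [b] give the same sum, and together they take every value
    other than [t a] and [t b]. *)
Lemma sum_perm_eval3 (R : numFieldType) k (a b e : 'I_k.+2)
    (H : 'I_k.+2 -> 'I_k.+2 -> 'I_k.+2 -> R) :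
  a != b -> e != a -> e != b ->
  k%:R * \sum_(t : 'S_k.+2) H (t a) (t b) (t e) =
  \sum_(t : 'S_k.+2)
    (\sum_z H (t a) (t b) z - H (t a) (t b) (t a) - H (t a) (t b) (t b)).
Proof.
move=> ab ea eb.
have ind d : (d != a) && (d != b) -> \sum_(t : 'S_k.+2) H (t a) (t b) (t d) =
    \sum_(t : 'S_k.+2) H (t a) (t b) (t e).
  move=> /andP[da db]; rewrite -(sum_perm_mull (tperm d e)).
  by apply: eq_bigr => t _; rewrite !permM tpermL !tpermD.
transitivity (\sum_(d | (d != a) && (d != b)) \sum_(t : 'S_k.+2) H (t a) (t b) (t d)).
  rewrite (eq_bigr _ ind) sumr_const mulr_natl; congr (_ *+ _).
  have := cardsC [set a; b]; rewrite cards2 ab card_ord => -[kE].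
  by rewrite -[LHS]kE; apply: eq_card => d; rewrite !inE negb_or.
rewrite exchange_big /=; apply: eq_bigr => t _.
rewrite -[X in _ = X - _ - _](sum_perm_image t).
rewrite [X in _ = X - _ - _](bigD1 a) //=.
rewrite [X in _ = _ + X - _ - _](bigD1 b) 1?eq_sym //=.
by rewrite [X in _ = X - _ - _]addrC addrK addrAC subrr add0r.
Qed.

Lemma sum_ltn_ord n m : (m <= n)%N -> (\sum_(y < n) (y < m) = m)%N.
Proof.
move=> mn; rewrite -{2}[m]card_ord -sum1_card [RHS](big_ord_widen n (fun _ => 1%N)) //.
by rewrite [RHS]big_mkcond; apply: eq_bigr => y _; case: ltnP.
Qed.

Lemma sum_ltn_perm (R : nzRingType) n (s : 'S_n) (a : 'I_n) :
  \sum_b (s b < s a)%N%:R = (s a)%:R :> R.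
Proof.
rewrite (sum_perm_image s (fun y => (y < s a)%N%:R)) -natr_sum.
by rewrite sum_ltn_ord // ltnW.
Qed.

Lemma sum_eqb (R : nzRingType) n (a : 'I_n) (F : 'I_n -> R) :
  \sum_d (d == a)%:R * F d = F a.
Proof.
rewrite (bigD1 a) //= eqxx mul1r big1 ?addr0 // => d /negbTE ->.
by rewrite mul0r.
Qed.

Lemma sum_gtn_perm (R : nzRingType) n (s : 'S_n) (a : 'I_n) :
  \sum_b (s a < s b)%N%:R = n%:R - 1 - (s a)%:R :> R.
Proof.
transitivity (\sum_b (1 - (b == a)%:R - (s b < s a)%N%:R : R)).
  apply: eq_bigr => b _; have [->|ba] := eqVneq b a; first by rewrite ltnn subrr subr0.
  case: ltngtP => [_|_|/val_inj/perm_inj e] /=; rewrite ?subr0 ?subrr //.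
  by rewrite e eqxx in ba.
rewrite !sumrB sum_ltn_perm sumr_const card_ord (bigD1 a) //= eqxx big1 ?addr0 //.
by move=> b /negbTE ->.
Qed.

(** * Convolution by weighted inversions and by fixed points *)

Definition convol (R : nzRingType) n (f F : 'S_n -> R) (s : 'S_n) : R :=
  \sum_t f (t^-1 * s)%g * F t.

Definition wdes (R : nzRingType) n (w : 'I_n -> 'I_n -> R) (g : 'S_n) : R :=
  \sum_a \sum_b w a b * (g b < g a)%N%:R.

(** Reindexing by [t] moves [t] into the weights and leaves only comparisons of values of [s]; both
    the eigenvector computations and the rank bound rest on this. *)
Lemma wdes_mulV (R : nzRingType) n (w : 'I_n -> 'I_n -> R) (s t : 'S_n) :
  wdes w (t^-1 * s)%g = \sum_a \sum_b w (t a) (t b) * (s b < s a)%N%:R.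
Proof.
rewrite -[LHS](sum_perm_image t); apply: eq_bigr => a _.
rewrite -[LHS](sum_perm_image t); apply: eq_bigr => b _.
by rewrite !permM !permK.
Qed.

Lemma nfix_mulV n (s t : 'S_n) :
  nfix (t^-1 * s)%g = (\sum_a (s a == t a))%N.
Proof.
rewrite /nfix -sum1_card big_mkcond /= (reindex_inj (@perm_inj _ t)).
by apply: eq_bigr => a _; rewrite inE permM permK; case: eqP.
Qed.

Lemma convol_wdes (R : comNzRingType) n (w : 'I_n -> 'I_n -> R) (F : 'S_n -> R) s :
  convol (wdes w) F s =
  \sum_a \sum_b (s b < s a)%N%:R * \sum_(t : 'S_n) w (t a) (t b) * F t.
Proof.
rewrite /convol; under eq_bigr => t _ do rewrite wdes_mulV mulr_suml.
rewrite exchange_big; apply: eq_bigr => a _ /=.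
under eq_bigr => t _ do rewrite mulr_suml.
rewrite exchange_big; apply: eq_bigr => b _ /=; rewrite mulr_sumr.
by apply: eq_bigr => t _; rewrite mulrAC mulrC.
Qed.

Lemma convol_nfix (R : comNzRingType) n (F : 'S_n -> R) s :
  convol (fun g => (nfix g)%:R) F s = \sum_a \sum_(t : 'S_n) (s a == t a)%:R * F t.
Proof.
rewrite /convol; under eq_bigr => t _ do rewrite nfix_mulV natr_sum mulr_suml.
by rewrite exchange_big.
Qed.

Lemma convolDl (R : nzRingType) n (f g F : 'S_n -> R) s :
  convol (fun x => f x + g x) F s = convol f F s + convol g F s.
Proof. by rewrite /convol -big_split; apply: eq_bigr => t _; rewrite mulrDl. Qed.

(** For fixed [d], the sum over [t] of [w (t a) (t b) * phi (t d)] is [A] if [d = a], [B] if [d = b]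
    and [C] otherwise; as [c] has sum zero, only the differences with [C] remain. *)
Lemma sum_wdes_point (R : numFieldType) k (w : 'I_k.+2 -> 'I_k.+2 -> R)
    (a b : 'I_k.+2) (c phi : 'I_k.+2 -> R)
    (A := k`!%:R * \sum_x \sum_y w x y * phi x)
    (B := k`!%:R * \sum_x \sum_y w x y * phi y)
    (C := k%:R^-1 * (k`!%:R * \sum_x \sum_y
                       w x y * (\sum_z phi z - phi x - phi y))) :
  (0 < k)%N -> (forall x, w x x = 0) -> a != b -> \sum_d c d = 0 ->
  \sum_(t : 'S_k.+2) w (t a) (t b) * \sum_d c d * phi (t d) =
  c a * (A - C) + c b * (B - C).
Proof.
move=> k0 w0 ab c0.
pose q d := \sum_(t : 'S_k.+2) w (t a) (t b) * phi (t d).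
have qa : q a = A.
  by rewrite /q (sum_perm_eval2 (G := fun x y => w x y * phi x)) // => x; rewrite w0 mul0r.
have qb : q b = B.
  by rewrite /q (sum_perm_eval2 (G := fun x y => w x y * phi y)) // => x; rewrite w0 mul0r.
have qe e : e != a -> e != b -> q e = C.
  move=> ea eb; apply: (@mulfI R k%:R); first by rewrite pnatr_eq0 -lt0n.
  rewrite (sum_perm_eval3 (fun x y z => w x y * phi z)) // /C mulVKf ?pnatr_eq0 -?lt0n //.
  rewrite -(sum_perm_eval2 _ ab) => [|x]; last by rewrite w0 mul0r.
  by apply: eq_bigr => t _; rewrite -mulr_sumr -!mulrBr.
have qE d : q d = C + (d == a)%:R * (A - C) + (d == b)%:R * (B - C).
  case: (eqVneq d a) => [->|da]; first by rewrite qa (negbTE ab) /=; ring.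
  case: (eqVneq d b) => [->|db]; first by rewrite qb /=; ring.
  by rewrite qe //=; ring.
transitivity (\sum_d c d * q d).
  under eq_bigr => t _ do rewrite mulr_sumr.
  rewrite exchange_big; apply: eq_bigr => d _ /=; rewrite mulr_sumr.
  by apply: eq_bigr => t _; rewrite mulrCA.
transitivity (\sum_d (c d * C + (d == a)%:R * (c d * (A - C)) +
                      (d == b)%:R * (c d * (B - C)))).
  by apply: eq_bigr => d _; rewrite qE; ring.
by rewrite !big_split /= -mulr_suml c0 mul0r add0r !sum_eqb.
Qed.

(** Summing the comparisons over the free position gives [s a] or [k + 1 - s a], whose constant part
    vanishes against [c]. So the image is a multiple of [\sum_d c d * s d] for every [phi], by a
    factor linear in [phi]. *)
Lemma convol_wdes_point (R : numFieldType) k (w : 'I_k.+2 -> 'I_k.+2 -> R)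
    (c phi : 'I_k.+2 -> R) s :
  (0 < k)%N -> (forall x, w x x = 0) -> \sum_d c d = 0 ->
  convol (wdes w) (fun t => \sum_d c d * phi (t d)) s =
  k`!%:R * (\sum_x \sum_y w x y * (phi x - phi y)) * \sum_d c d * (s d)%:R.
Proof.
move=> k0 w0 c0; rewrite convol_wdes.
set A := k`!%:R * \sum_x \sum_y w x y * phi x.
set B := k`!%:R * \sum_x \sum_y w x y * phi y.
set C := k%:R^-1 * (k`!%:R * \sum_x \sum_y
                       w x y * (\sum_z phi z - phi x - phi y)).
transitivity (\sum_a \sum_b ((s b < s a)%N%:R * (c a * (A - C)) +
                             (s b < s a)%N%:R * (c b * (B - C)))).
  apply: eq_bigr => a _; apply: eq_bigr => b _; rewrite -mulrDr.
  have [->|ab] := eqVneq a b; first by rewrite ltnn !mul0r.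
  by rewrite (sum_wdes_point phi k0 w0 ab c0).
under eq_bigr => a _ do rewrite big_split /=.
rewrite big_split /= [X in _ + X]exchange_big /=.
under eq_bigr => a _ do rewrite -mulr_suml sum_ltn_perm.
under [X in _ + X]eq_bigr => a _ do rewrite -mulr_suml sum_gtn_perm.
have -> : k`!%:R * (\sum_x \sum_y w x y * (phi x - phi y)) = (A - C) - (B - C).
  rewrite opprB addrA subrK /A /B -mulrBr -sumrB; congr (_ * _).
  apply: eq_bigr => x _; rewrite -sumrB; apply: eq_bigr => y _; exact: mulrBr.
transitivity (\sum_a (((A - C) - (B - C)) * (c a * (s a)%:R) +
                       c a * ((k.+2%:R - 1) * (B - C)))).
  by rewrite -big_split; apply: eq_bigr => a _ /=; ring.
by rewrite big_split /= -mulr_sumr -mulr_suml c0 mul0r addr0.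
Qed.

Lemma convol_nfix_point (R : numFieldType) k (c phi : 'I_k.+2 -> R) s :
  \sum_d c d = 0 ->
  convol (fun g => (nfix g)%:R) (fun t => \sum_d c d * phi (t d)) s =
  (k.+2 * k`!)%:R * \sum_d c d * phi (s d).
Proof.
move=> c0; rewrite convol_nfix; set Phi := \sum_x phi x.
pose q m d := \sum_(t : 'S_k.+2) (s m == t m)%:R * phi (t d).
have qm m : q m m = k.+1`!%:R * phi (s m).
  rewrite /q (sum_perm_eval m (fun x => (s m == x)%:R * phi x)).
  by under eq_bigr => x _ do rewrite eq_sym; rewrite sum_eqb.
have qd m d : d != m -> q m d = k`!%:R * (Phi - phi (s m)).
  move=> dm; rewrite /q.
  (* The inserted factor equals 1 and makes the summand vanish on the diagonal, as [sum_perm_eval2]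
     requires. *)
  transitivity (\sum_(t : 'S_k.+2) (t d != t m)%:R * ((s m == t m)%:R * phi (t d))).
    by apply: eq_bigr => t _; rewrite (inj_eq perm_inj) dm mul1r.
  rewrite (sum_perm_eval2 (G := fun x y => (y != x)%:R * ((s m == x)%:R * phi y)));
    [|by move=> x; rewrite eqxx mul0r|by rewrite eq_sym].
  congr (_ * _).
  transitivity (\sum_x (x == s m)%:R * \sum_y (y != x)%:R * phi y).
    apply: eq_bigr => x _; rewrite mulr_sumr; apply: eq_bigr => y _.
    by rewrite [s m == x]eq_sym mulrCA.
  rewrite sum_eqb /Phi (bigD1 (s m)) //= eqxx mul0r add0r [in RHS](bigD1 (s m)) //=.
  by rewrite [RHS]addrC addKr; apply: eq_bigr => y ->; rewrite mul1r.
have qE m d : q m d = k`!%:R * (Phi - phi (s m)) +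
    (d == m)%:R * (k.+1`!%:R * phi (s m) - k`!%:R * (Phi - phi (s m))).
  by case: (eqVneq d m) => [->|dm]; [rewrite qm|rewrite qd //] => /=; ring.
transitivity (\sum_m \sum_d c d * q m d).
  apply: eq_bigr => m _.
  under eq_bigr => t _ do rewrite mulr_sumr.
  rewrite exchange_big; apply: eq_bigr => d _ /=; rewrite mulr_sumr.
  by apply: eq_bigr => t _; rewrite mulrCA.
(* The coefficient of [c m * phi (s m)] is (k+1)! + k! = (k+2) k!; the term in [Phi] disappears
   since [c] has sum zero. *)
transitivity (\sum_m (c m * ((k.+2 * k`!)%:R * phi (s m)) - c m * (k`!%:R * Phi))).
  apply: eq_bigr => m _.
  transitivity (\sum_d (c d * (k`!%:R * (Phi - phi (s m))) + (d == m)%:R *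
      (c d * (k.+1`!%:R * phi (s m) - k`!%:R * (Phi - phi (s m)))))).
    by apply: eq_bigr => d _; rewrite qE; ring.
  rewrite big_split /= -mulr_suml c0 mul0r add0r sum_eqb factS !natrM; ring.
rewrite sumrB -mulr_suml c0 mul0r subr0 mulr_sumr.
by apply: eq_bigr => m _; rewrite mulrCA.
Qed.

(* Antisymmetrizing in [d], [e] leaves [q d e - q e d], in which a term [u d - u e]
   is killed by the zero row sums of [c]. *)
Lemma sum_skew (R : numFieldType) n (c q : 'I_n -> 'I_n -> R) (u : 'I_n -> R)
    (kappa : R) (a b : 'I_n) :
  (forall d e, c e d = - c d e) -> (forall d, \sum_e c d e = 0) ->
  (forall d e, q d e - q e d =
    u d - u e + kappa * ((d == a)%:R * (e == b)%:R - (d == b)%:R * (e == a)%:R)) ->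
  \sum_d \sum_e c d e * q d e = kappa * c a b.
Proof.
move=> cN c0 qE; set S := LHS.
have SE : S = - \sum_d \sum_e c d e * q e d.
  rewrite /S exchange_big /= -sumrN; apply: eq_bigr => d _.
  by rewrite -sumrN; apply: eq_bigr => e _; rewrite cN mulNr.
apply: (@mulfI R 2); first by rewrite pnatr_eq0.
transitivity (\sum_d \sum_e c d e * (q d e - q e d)).
  rewrite [LHS]mulr_natl mulr2n {2}SE /S -sumrB; apply: eq_bigr => d _.
  by rewrite -sumrB; apply: eq_bigr => e _; rewrite mulrBr.
transitivity (\sum_d \sum_e (c d e * u d + c e d * u e +
   ((d == a)%:R * ((e == b)%:R * (kappa * c d e)) +
    (d == b)%:R * ((e == a)%:R * (kappa * c e d))))).
  by apply: eq_bigr => d _; apply: eq_bigr => e _; rewrite qE [c e d]cN; ring.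
under eq_bigr => d _ do rewrite !big_split /= -mulr_suml c0 mul0r add0r.
rewrite !big_split /= exchange_big /= big1 ?add0r => [|e _]; last first.
  by rewrite -mulr_suml c0 mul0r.
under eq_bigr => d _ do rewrite -mulr_sumr sum_eqb.
under [X in _ + X]eq_bigr => d _ do rewrite -mulr_sumr sum_eqb.
by rewrite !sum_eqb; ring.
Qed.

(** The antisymmetrization [r] of [q] vanishes unless [d] or [e] is [a] or [b], and it has the shape
    required by [sum_skew], with [u] equal to [y1] at [a] and [y2] at [b], and
    [kappa = z - y1 + y2]. *)
Lemma sum_wdes_skew (R : numFieldType) k (w : 'I_k.+2 -> 'I_k.+2 -> R)
    (a b : 'I_k.+2) (c : 'I_k.+2 -> 'I_k.+2 -> R) :
  (0 < k)%N -> (forall x y : 'I_k.+2, (y <= x)%N -> w x y = 0) -> a != b ->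
  (forall d e, c e d = - c d e) -> (forall d, \sum_e c d e = 0) ->
  \sum_(t : 'S_k.+2) w (t a) (t b) * \sum_d \sum_e c d e * (t d < t e)%N%:R =
  k%:R^-1 * (k`!%:R * \sum_x \sum_y w x y * (k.+2%:R - 2 * (y%:R - x%:R))) * c a b.
Proof.
move=> k0 w0 ab cN c0.
have wxx x : w x x = 0 by exact: w0.
have kn0 : k%:R != 0 :> R by rewrite pnatr_eq0 -lt0n.
have k2 : k.+2%:R = k%:R + 2 :> R by rewrite -addn2 natrD.
pose sg (x y : 'I_k.+2) : R := (x < y)%N%:R - (y < x)%N%:R.
have sgxx x : sg x x = 0 by rewrite /sg subrr.
have sgC x y : sg y x = - sg x y by rewrite /sg opprB.
have sum_sg x : \sum_z sg x z = k%:R + 1 - 2 * x%:R.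
  rewrite sumrB; have := sum_gtn_perm R (1 : 'S_k.+2) x.
  have := sum_ltn_perm R (1 : 'S_k.+2) x.
  rewrite !perm1; under eq_bigr => z _ do rewrite perm1.
  move=> ->; under eq_bigr => z _ do rewrite perm1.
  by move=> ->; rewrite k2; ring.
have wsg x y : w x y * sg x y = w x y.
  case: (leqP y x) => [yx|xy]; first by rewrite w0 ?mul0r.
  by rewrite /sg xy ltnNge ltnW // subr0 mulr1.
pose q d e := \sum_(t : 'S_k.+2) w (t a) (t b) * (t d < t e)%N%:R.
pose r d e := \sum_(t : 'S_k.+2) w (t a) (t b) * sg (t d) (t e).
have rE d e : q d e - q e d = r d e.
  by rewrite -sumrB; apply: eq_bigr => t _; rewrite -mulrBr.
have rN d e : r e d = - r d e.
  by rewrite -sumrN; apply: eq_bigr => t _; rewrite sgC mulrN.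
(* For [e] outside [{a, b}], these are the values of [r a e], [r b e] and [r a b]. The factors come
   from [k + 1 - 2 x], resp. [k + 1 - 2 y], by removing the excluded term, [sg x y = 1], resp.
   [sg y x = -1]. *)
pose y1 := k%:R^-1 * (k`!%:R * \sum_x \sum_y w x y * (k%:R - 2 * x%:R)).
pose y2 := k%:R^-1 * (k`!%:R * \sum_x \sum_y w x y * (k.+2%:R - 2 * y%:R)).
pose z := k`!%:R * \sum_x \sum_y w x y.
have ra e : e != a -> e != b -> r a e = y1.
  move=> ea eb; apply: (mulfI kn0).
  rewrite (sum_perm_eval3 (fun x y z => w x y * sg x z)) // /y1 mulVKf //.
  rewrite -(sum_perm_eval2 _ ab) => [|x]; last by rewrite wxx mul0r.
  apply: eq_bigr => t _; rewrite -mulr_sumr sum_sg sgxx wsg; ring.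
have rb e : e != a -> e != b -> r b e = y2.
  move=> ea eb; apply: (mulfI kn0).
  rewrite (sum_perm_eval3 (fun x y z => w x y * sg y z)) // /y2 mulVKf //.
  rewrite -(sum_perm_eval2 _ ab) => [|x]; last by rewrite wxx mul0r.
  apply: eq_bigr => t _; rewrite -mulr_sumr sum_sg sgxx sgC mulrN wsg.
  by rewrite k2; ring.
have rab : r a b = z.
  rewrite /z -(sum_perm_eval2 _ ab) //.
  by apply: eq_bigr => t _; rewrite wsg.
have rxx d : r d d = 0 by rewrite /r big1 // => t _; rewrite sgxx mulr0.
(* Exchanging [d] and [e] preserves the weight and changes the sign of [sg]. *)
have r0 d e : d != a -> d != b -> e != a -> e != b -> r d e = 0.
  move=> da db ea eb; suff /eqP : r d e = - r d e.
    by rewrite -subr_eq0 opprK -mulr2n mulrn_eq0 => /eqP.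
  rewrite -rN /r -(sum_perm_mull (tperm d e)); apply: eq_bigr => t _.
  by rewrite !permM tpermL tpermR !tpermD.
have -> : k%:R^-1 * (k`!%:R * \sum_x \sum_y w x y * (k.+2%:R - 2 * (y%:R - x%:R))) =
    z - y1 + y2.
  rewrite /z /y1 /y2 -[k`!%:R * \sum_x \sum_y w x y](mulKf kn0) -mulrBr -mulrDr.
  congr (_ * _); rewrite mulrCA -mulrBr -mulrDr; congr (_ * _).
  rewrite mulr_sumr -sumrB -big_split; apply: eq_bigr => x _ /=.
  rewrite mulr_sumr -sumrB -big_split; apply: eq_bigr => y _ /=.
  by rewrite k2; ring.
transitivity (\sum_d \sum_e c d e * q d e).
  under eq_bigr => t _ do rewrite mulr_sumr.
  rewrite exchange_big; apply: eq_bigr => d _ /=.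
  under eq_bigr => t _ do rewrite mulr_sumr.
  rewrite exchange_big; apply: eq_bigr => e _ /=; rewrite mulr_sumr.
  by apply: eq_bigr => t _; rewrite mulrCA.
have ba : b == a = false by rewrite eq_sym; apply/negbTE.
apply: (sum_skew (u := fun d => (d == a)%:R * y1 + (d == b)%:R * y2)) => // d e.
rewrite rE.
case: (eqVneq d a) => [->|da]; last case: (eqVneq d b) => [->|db];
  (case: (eqVneq e a) => [->|ea]; last case: (eqVneq e b) => [->|eb]);
  rewrite ?(negbTE ab) ?ba ?eqxx /=.
- by rewrite rxx; ring.
- by rewrite rab; ring.
- by rewrite ra //; ring.
- by rewrite rN rab; ring.
- by rewrite rxx; ring.
- by rewrite rb //; ring.
- by rewrite rN ra //; ring.
- by rewrite rN rb //; ring.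
- by rewrite r0 //; ring.
Qed.

Lemma convol_wdes_skew (R : numFieldType) k (w : 'I_k.+2 -> 'I_k.+2 -> R)
    (c : 'I_k.+2 -> 'I_k.+2 -> R) s :
  (0 < k)%N -> (forall x y : 'I_k.+2, (y <= x)%N -> w x y = 0) ->
  (forall d e, c e d = - c d e) -> (forall d, \sum_e c d e = 0) ->
  convol (wdes w) (fun t => \sum_d \sum_e c d e * (t d < t e)%N%:R) s =
  - (k%:R^-1 * (k`!%:R * \sum_x \sum_y w x y * (k.+2%:R - 2 * (y%:R - x%:R)))) *
  \sum_d \sum_e c d e * (s d < s e)%N%:R.
Proof.
(* The exchange matches the comparison [s b < s a] with the pair [(b, a)]; the antisymmetry of [c]
   then gives the minus sign. *)
move=> k0 w0 cN c0; rewrite convol_wdes exchange_big mulr_sumr; apply: eq_bigr => b _ /=.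
rewrite mulr_sumr; apply: eq_bigr => a _.
case: (eqVneq a b) => [->|ab]; first by rewrite ltnn !mulr0 mul0r.
by rewrite sum_wdes_skew // cN; ring.
Qed.

(** Permuting positions while fixing [m] preserves the weight [s m == t m]. So [q m f] and [q f m]
    do not depend on [f != m], [q] is symmetric away from [m], and [sum_skew] applies with
    [kappa = 0]. *)
Lemma convol_nfix_skew (R : numFieldType) n (c : 'I_n -> 'I_n -> R) s :
  (forall d e, c e d = - c d e) -> (forall d, \sum_e c d e = 0) ->
  convol (fun g => (nfix g)%:R)
    (fun t => \sum_d \sum_e c d e * (t d < t e)%N%:R) s = 0.
Proof.
move=> cN c0; rewrite convol_nfix big1 // => m _.
pose q d e : R := \sum_(t : 'S_n) (s m == t m)%:R * (t d < t e)%N%:R.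
have qC d e (p : 'S_n) : p m = m -> q (p d) (p e) = q d e.
  move=> pm; rewrite [RHS]/q -(sum_perm_mull p); apply: eq_bigr => t _.
  by rewrite !permM pm.
(* A reference index other than [m]; the default is reached only when [m] is the sole index. *)
pose e0 := odflt m [pick e | e != m].
have e0P e : e != m -> e0 != m.
  by rewrite /e0; case: pickP => //= h em; have := h e; rewrite em.
transitivity (\sum_d \sum_e c d e * q d e).
  under eq_bigr => t _ do rewrite mulr_sumr.
  rewrite exchange_big; apply: eq_bigr => d _ /=.
  under eq_bigr => t _ do rewrite mulr_sumr.
  rewrite exchange_big; apply: eq_bigr => e _ /=; rewrite mulr_sumr.
  by apply: eq_bigr => t _; rewrite mulrCA.
rewrite (sum_skew (a := m) (b := m) (kappa := 0)
  (u := fun d => (d == m)%:R * (q m e0 - q e0 m))) ?mul0r // => d e.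
have qm f : f != m -> (q m f = q m e0) * (q f m = q e0 m).
  move=> fm; have pm : tperm f e0 m = m by rewrite tpermD // (e0P f).
  by split; rewrite -[LHS](qC _ _ _ pm) pm tpermL.
case: (eqVneq d m) => [->|dm]; case: (eqVneq e m) => [->|em] /=; try ring.
- by rewrite !(qm e) //; ring.
- by rewrite !(qm d) //; ring.
have pm : tperm d e m = m by rewrite tpermD.
by rewrite -[X in X - _](qC _ _ _ pm) tpermL tpermR; ring.
Qed.

(* The first summand accounts for [inv], the second for [maj]. *)
Definition maj_inv_weight (R : nzRingType) n (x y : 'I_n) : R :=
  (x < y)%N%:R + x.+1%:R * (y == x.+1 :> nat)%:R.

Lemma maj_inv_weight_eq0 (R : nzRingType) n (x y : 'I_n) : (y <= x)%N -> maj_inv_weight R x y = 0.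
Proof.
move=> yx; rewrite /maj_inv_weight ltnNge yx add0r ltn_eqF ?mulr0 //.
Qed.

(** * Weighted form of [maj] and [inv], and sums of the weights *)

Lemma maj_inv_wdes (R : nzRingType) n (g : 'S_n) :
  (maj g + Defs.inv g)%:R = wdes (maj_inv_weight R (n := n)) g.
Proof.
have -> : Defs.inv g = (\sum_(a : 'I_n) \sum_(b : 'I_n) (a < b)%N * (g b < g a)%N)%N.
  rewrite pair_bigA /= /Defs.inv -sum1_card big_mkcond; apply: eq_bigr => -[a b] _ /=.
  by rewrite inE /=; case: (a < b)%N; case: (g b < g a)%N.
have -> : maj g = (\sum_(a : 'I_n) \sum_(b : 'I_n) a.+1 * (b == a.+1 :> nat) * (g b < g a)%N)%N.
  rewrite /maj big_mkcond; apply: eq_bigr => a _; rewrite inE.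
  case: existsP => [[b /andP[/eqP ba gba]]|no].
    rewrite (bigD1 b) //= ba eqxx gba !muln1 big1 ?addn0 // => c cb.
    by rewrite -ba (inj_eq val_inj) (negbTE cb) muln0.
  rewrite big1 // => b _; case: eqP => [ba|]; last by rewrite muln0.
  by case: ltnP => gba; rewrite ?muln0 //; case: no; exists b; rewrite ba eqxx.
rewrite -big_split natr_sum; apply: eq_bigr => a _.
rewrite -big_split natr_sum; apply: eq_bigr => b _ /=.
by rewrite -mulnDl natrM natrD natrM addrC.
Qed.

(** The descent part of column [y] sees only [x = y - 1], with factor [x + 1 = y]; for [y = 0] this
    factor cancels the spurious [F y.-1]. *)
Lemma sum_maj_inv_weight_col (R : nzRingType) n (y : 'I_n) (F : nat -> R) :
  \sum_(x < n) maj_inv_weight R x y * F x = \sum_(x < y) F x + y%:R * F y.-1.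
Proof.
under eq_bigr => x _ do rewrite /maj_inv_weight mulrDl.
rewrite big_split /=; congr (_ + _).
  rewrite (big_ord_widen n) ?(ltnW (ltn_ord y)) // [RHS]big_mkcond.
  by apply: eq_bigr => x _; case: ltnP => _; rewrite ?mul1r ?mul0r.
case: y => -[|z] zn /=; first by rewrite big1 ?mul0r // => x _; rewrite mulr0 mul0r.
rewrite (bigD1 (Ordinal (ltnW zn))) //= eqxx mulr1 big1 ?addr0 // => x xz.
suff -> : (z.+1 == x.+1)%N = false by rewrite mulr0 mul0r.
by rewrite eqSS eq_sym; apply: contraNF xz.
Qed.

Lemma sum_ord_natr (R : numFieldType) n : \sum_(x < n) x%:R = n%:R * (n%:R - 1) / 2 :> R.
Proof.
elim: n => [|n IH]; first by rewrite big_ord0 !mul0r.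
by rewrite big_ord_recr /= IH -natr1; field.
Qed.

Lemma sum_maj_inv_weight (R : numFieldType) n :
  \sum_(x < n) \sum_(y < n) maj_inv_weight R x y = n%:R * (n%:R - 1).
Proof.
rewrite exchange_big /=.
(* Column [y] receives [y] from the inversions and [y] from the descents. *)
transitivity (\sum_(y < n) (2 * y%:R : R)).
  apply: eq_bigr => y _; under eq_bigr => x _ do rewrite -[maj_inv_weight _ _ _]mulr1.
  by rewrite (sum_maj_inv_weight_col y (fun _ => 1)) sumr_const card_ord; ring.
by rewrite -mulr_sumr sum_ord_natr; field.
Qed.

Lemma sum_maj_inv_weight_diff (R : numFieldType) n :
  \sum_(x < n) \sum_(y < n) maj_inv_weight R x y * (y%:R - x%:R) =
  n%:R * (n%:R - 1) * (n%:R + 4) / 6.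
Proof.
rewrite exchange_big /=.
(* The inversions give [y * (y + 1) / 2] and the descents give [y]. *)
transitivity (\sum_(y < n) (y%:R * (y%:R + 3) / 2 : R)).
  apply: eq_bigr => y _; rewrite (sum_maj_inv_weight_col y (fun x => y%:R - x%:R)).
  rewrite sumrB sumr_const card_ord sum_ord_natr.
  case: (nat_of_ord y) => [|z] /=; first by ring.
  by rewrite -natr1; field.
elim: n => [|n IH]; first by rewrite big_ord0 !mul0r.
by rewrite big_ord_recr /= IH -natr1; field.
Qed.

(** Used with [m = n] for all pairs, and with [m = n - 1] for those avoiding the last index. *)
Lemma card_ltn_pairs n m : (m <= n)%N ->
  #|[set p : 'I_n * 'I_n | (p.1 < p.2 < m)%N]| = 'C(m, 2).
Proof.
move=> mn.
transitivity (\sum_(x < n) \sum_(y < n) (x < y < m))%N.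
  rewrite pair_bigA -sum1_card big_mkcond; apply: eq_bigr => -[x y] _ /=.
  by rewrite inE; case: (_ && _).
rewrite exchange_big /= -bin2_sum big_mkord [RHS](big_ord_widen n (fun i => i)) //.
rewrite [RHS]big_mkcond /=.
apply: eq_bigr => y _; case: ifP => ym.
  rewrite -[RHS](@sum_ltn_ord n) ?(ltnW (ltn_ord y)) //.
  by apply: eq_bigr => x _; rewrite andbT.
by rewrite big1 // => x _; rewrite andbF.
Qed.

(** * Action of [maj + inv + nfix] on the eigenvector families *)

Definition mif (R : nzRingType) n : 'S_n -> R :=
  fun g => wdes (maj_inv_weight R (n := n)) g + (nfix g)%:R.

Lemma convol_mif1 (R : numFieldType) k (s : 'S_k.+2) :
  convol (mif R (n := k.+2)) (fun _ => 1) s =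
  k.+2`!%:R * 'C(k.+2, 2)%:R + k.+2`!%:R.
Proof.
rewrite convolDl convol_wdes convol_nfix; congr (_ + _).
  transitivity (\sum_a \sum_b (s b < s a)%N%:R * (k.+2`!%:R : R)).
    apply: eq_bigr => a _; apply: eq_bigr => b _.
    case: (eqVneq a b) => [->|ab]; first by rewrite ltnn !mul0r.
    congr (_ * _); under eq_bigr => t _ do rewrite mulr1.
    rewrite (sum_perm_eval2 (G := fun x y => maj_inv_weight R x y)) // => [|x]; last exact: maj_inv_weight_eq0.
    by rewrite sum_maj_inv_weight 2!factS !natrM -!natr1; ring.
  under eq_bigr => a _ do rewrite -mulr_suml sum_ltn_perm.
  rewrite -mulr_suml mulrC (sum_perm_image s (fun x => x%:R)) -natr_sum.
  by rewrite -bin2_sum big_mkord.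
transitivity (\sum_(a : 'I_k.+2) (k.+1`!%:R : R)).
  apply: eq_bigr => a _; under eq_bigr => t _ do rewrite mulr1.
  rewrite (sum_perm_eval a (fun x => (s a == x)%:R)).
  under eq_bigr => x _ do rewrite -[_%:R]mulr1 eq_sym.
  by rewrite sum_eqb mulr1.
by rewrite sumr_const card_ord [in RHS]factS natrM mulr_natl.
Qed.

(** This yields two kinds of eigenvectors: for [phi y = y] both terms are multiples of the same sum,
    and when the double sum vanishes only the first term remains. *)
Lemma convol_mif_point (R : numFieldType) k (c phi : 'I_k.+2 -> R) s :
  (0 < k)%N -> \sum_d c d = 0 ->
  convol (mif R (n := k.+2)) (fun t => \sum_d c d * phi (t d)) s =
  k.+2%:R * k`!%:R * (\sum_d c d * phi (s d)) +
  k`!%:R * (\sum_x \sum_y maj_inv_weight R x y * (phi x - phi y)) * \sum_d c d * (s d)%:R.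
Proof.
move=> k0 c0; rewrite convolDl convol_nfix_point // natrM addrC.
by rewrite convol_wdes_point // => x; apply: maj_inv_weight_eq0.
Qed.

Lemma convol_mif_skew (R : numFieldType) k (c : 'I_k.+2 -> 'I_k.+2 -> R) s :
  (0 < k)%N ->
  (forall d e, c e d = - c d e) -> (forall d, \sum_e c d e = 0) ->
  convol (mif R (n := k.+2)) (fun t => \sum_d \sum_e c d e * (t d < t e)%N%:R) s =
  - (2 * k.+2`!%:R / 3) * \sum_d \sum_e c d e * (s d < s e)%N%:R.
Proof.
move=> k0 cN c0; rewrite convolDl convol_nfix_skew // addr0.
rewrite convol_wdes_skew //; last by move=> x y; apply: maj_inv_weight_eq0.
congr (- _ * _).
(* With [n = k + 2] this is [n * (n - 1) * (2 * n - 4) / 3], that is [2 * k * n * (n - 1) / 3],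
   whose factor [k] cancels the inverse. *)
have -> : \sum_(x < k.+2) \sum_(y < k.+2) maj_inv_weight R x y * (k.+2%:R - 2 * (y%:R - x%:R)) =
    k.+2%:R * (k.+2%:R * (k.+2%:R - 1)) -
    2 * (k.+2%:R * (k.+2%:R - 1) * (k.+2%:R + 4) / 6).
  rewrite -sum_maj_inv_weight_diff -sum_maj_inv_weight !mulr_sumr -sumrB; apply: eq_bigr => x _.
  by rewrite !mulr_sumr -sumrB; apply: eq_bigr => y _; ring.
have kn0 : k%:R != 0 :> R by rewrite pnatr_eq0 -lt0n.
by rewrite 2!factS !natrM -!natr1; field.
Qed.

(** * Eigenspaces and rank *)

Lemma perm_exists2 n (a b x y : 'I_n) : a != b -> x != y ->
  exists t : 'S_n, t a = x /\ t b = y.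
Proof.
move=> ab xy; exists (tperm a x * tperm (tperm a x b) y)%g.
rewrite !permM tpermL; split; last exact: tpermL.
have zx : tperm a x b != x by rewrite -{2}(tpermL a x) (inj_eq perm_inj) eq_sym.
by rewrite (tpermD zx) // eq_sym.
Qed.

(* Comparing [t] with [tperm a b * t], where [t a = x] and [t b = x0], gives
   [Psi a x = Psi b x]. *)
Lemma point_indep (R : numFieldType) n (Psi : 'I_n -> 'I_n -> R) x0 :
  (forall t : 'S_n, \sum_d Psi d (t d) = 0) -> (forall x, \sum_d Psi d x = 0) ->
  (forall d, Psi d x0 = 0) -> forall d x, Psi d x = 0.
Proof.
move=> P0 Pc Px0 a x; have [->//|xx0] := eqVneq x x0.
have PE b : Psi b x = Psi a x.
  have [->//|ba] := eqVneq b a; rewrite eq_sym in ba.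
  have [t [ta tb]] := perm_exists2 ba xx0.
  have := etrans (P0 (tperm a b * t)%g) (esym (P0 t)).
  have ab : b != a by rewrite eq_sym.
  rewrite (bigD1 a) // (bigD1 b) //= [RHS](bigD1 a) // [in RHS](bigD1 b) //=.
  rewrite !permM tpermL tpermR ta tb !Px0 !add0r.
  rewrite (eq_bigr (fun d => Psi d (t d))) => [/addIr //|d /andP[da db]].
  by rewrite permM tpermD // eq_sym.
apply/eqP; have := Pc x; rewrite (eq_bigr _ (fun b _ => PE b)) sumr_const card_ord.
move/eqP; rewrite mulrn_eq0 => /orP[/eqP n0|//].
by have := ltn_ord a; rewrite [X in (_ < X)%N]n0.
Qed.

(* Exchanging the values of [a] and [b] when they are the consecutive values
   [0] and [1] changes the sum by [2 * c a b]. *)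
Lemma skew_indep (R : numFieldType) k (c : 'I_k.+2 -> 'I_k.+2 -> R) :
  (forall d e, c e d = - c d e) ->
  (forall t : 'S_k.+2, \sum_d \sum_e c d e * (t d < t e)%N%:R = 0) ->
  forall d e, c d e = 0.
Proof.
move=> cN c0 a b; have [->|ab] := eqVneq a b.
  by apply/eqP; have /eqP := cN b b; rewrite -subr_eq0 opprK -mulr2n mulrn_eq0.
have [t [ta tb]] := perm_exists2 ab (isT : (ord0 != lift ord0 ord0 :> 'I_k.+2)).
have tge d : d != a -> d != b -> (2 <= t d)%N.
  rewrite -(inj_eq (@perm_inj _ t)) -[d == b](inj_eq (@perm_inj _ t)) ta tb.
  by rewrite -!val_eqE /=; case: (nat_of_ord (t d)) => [|[]].
have ba : b == a = false by rewrite eq_sym; apply/negbTE.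
have tE d e : (t d < t e)%N%:R - ((tperm a b * t)%g d < (tperm a b * t)%g e)%N%:R =
    (d == a)%:R * (e == b)%:R - (d == b)%:R * (e == a)%:R :> R.
  rewrite !permM; have ab' := negbTE ab.
  have [td te] := (tge d, tge e).
  case: (eqVneq d a) td => [-> _|da]; last case: (eqVneq d b) => [-> _|db /(_ isT isT) td];
    (case: (eqVneq e a) te => [-> _|ea]; last case: (eqVneq e b) => [-> _|eb /(_ isT isT) te]);
    rewrite ?ba ?ab' ?eqxx ?tpermL ?tpermR ?ta ?tb /=.
  - by rewrite ?ltnn; ring.
  - by ring.
  - by rewrite ?tpermD 1?eq_sym //; case: (nat_of_ord (t e)) te => [|[|m]] //= _; ring.
  - by ring.
  - by rewrite ?ltnn; ring.
  - by rewrite ?tpermD 1?eq_sym //; case: (nat_of_ord (t e)) te => [|[|m]] //= _; ring.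
  - by rewrite ?tpermD 1?eq_sym //; case: (nat_of_ord (t d)) td => [|[|m]] //= _; ring.
  - by rewrite ?tpermD 1?eq_sym //; case: (nat_of_ord (t d)) td => [|[|m]] //= _; ring.
  - by rewrite (tpermD (z := d)) 1?eq_sym // (tpermD (z := e)) 1?eq_sym //; ring.
have := congr2 (fun u v => u - v) (c0 t) (c0 (tperm a b * t)%g).
rewrite -sumrB subr0; under eq_bigr => d _.
  rewrite -sumrB; under eq_bigr => e _ do rewrite -mulrBr tE mulrC mulrBl -!mulrA.
  rewrite sumrB -!mulr_sumr !sum_eqb; over.
rewrite sumrB !sum_eqb [c b a]cN opprK -mulr2n => /eqP.
by rewrite mulrn_eq0 => /eqP.
Qed.

(** Since [eigenspace] consists of row vectors, rows are indexed by [t] and columns by [s]: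
    multiplying a row vector by this matrix is then [convol f]. *)
Definition conv_mx (R : nzRingType) n (f : 'S_n -> R) : 'M[R]_#|{: 'S_n}| :=
  \matrix_(i, j) f ((enum_val i)^-1 * enum_val j)%g.

Definition family_mx (R : nzRingType) n (T : finType) (A : {set T})
    (K : T -> 'S_n -> R) : 'M[R]_(#|A|, #|{: 'S_n}|) :=
  \matrix_(i, j) K (enum_val i) (enum_val j).

Lemma rank_eigenspace_family (R : fieldType) n (f : 'S_n -> R) (T : finType)
    (A : {set T}) (K : T -> 'S_n -> R) (l : R) :
  (forall i s, i \in A -> convol f (K i) s = l * K i s) ->
  (forall c : T -> R, (forall s, \sum_(i in A) c i * K i s = 0) ->
    forall i, i \in A -> c i = 0) ->
  (#|A| <= \rank (eigenspace (conv_mx f) l))%N.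
Proof.
move=> fK Kfree; have : row_free (family_mx A K).
  apply: inj_row_free => v v0; apply/rowP => i; rewrite mxE.
  (* The vector [v] as a function on all of [T], zero outside [A]. *)
  pose c (t : T) := \sum_(j | enum_val j == t) v 0 j.
  have cE j : c (enum_val j) = v 0 j.
    rewrite /c (big_pred1 j) // => j'; exact: (inj_eq enum_val_inj).
  rewrite -cE; apply: (Kfree c) (enum_valP i) => s.
  have /rowP /(_ (enum_rank s)) := v0; rewrite !mxE => v0s.
  apply: etrans v0s.
  rewrite big_enum_val; apply: eq_bigr => j _.
  by rewrite !mxE cE enum_rankK.
rewrite /row_free => /eqP <-; apply: mxrankS; apply/eigenspaceP.
apply/matrixP => i j; rewrite !mxE -fK ?enum_valP // /convol.
rewrite [RHS](reindex (@enum_val _ (mem 'S_n))) /=; last first.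
  by apply: onW_bij; apply: enum_val_bij.
by apply: eq_bigr => h _; rewrite !mxE mulrC.
Qed.

(** The expansion factors the matrix through a space of dimension [#|A|]. *)
Lemma rank_span_family (R : fieldType) n (h : 'S_n -> 'S_n -> R) (T : finType)
    (A : {set T}) (K : T -> 'S_n -> R) (c : 'S_n -> T -> R) :
  (forall t s, h t s = \sum_(i in A) c t i * K i s) ->
  (\rank (\matrix_(i < #|{: 'S_n}|, j < #|{: 'S_n}|)
     h (enum_val i) (enum_val j)) <= #|A|)%N.
Proof.
move=> hE; set H := \matrix_(_, _) _.
have -> : H = \matrix_(i, j) c (enum_val i) (enum_val j) *m family_mx A K.
  apply/matrixP => i j; rewrite !mxE hE big_enum_val.
  by apply: eq_bigr => l _; rewrite !mxE.
exact: leq_trans (mxrankM_maxr _ _) (rank_leq_row _).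
Qed.

(** * Upper bound on the rank *)

Definition lt_pairs n : {set 'I_n * 'I_n} :=
  [set p : 'I_n * 'I_n | (p.1 < p.2)%N].

Lemma sum_lt_pairs (R : nmodType) n (G : 'I_n -> 'I_n -> R) :
  (forall a, G a a = 0) ->
  \sum_a \sum_b G a b = \sum_(p in lt_pairs n) (G p.1 p.2 + G p.2 p.1).
Proof.
move=> G0; have -> : \sum_a \sum_b G a b =
    \sum_(a : 'I_n) \sum_(b : 'I_n) (if (a < b)%N then G a b else 0) +
    \sum_(a : 'I_n) \sum_(b : 'I_n) (if (b < a)%N then G a b else 0).
  rewrite -big_split; apply: eq_bigr => a _; rewrite -big_split; apply: eq_bigr => b _ /=.
  by case: ltngtP => [||/val_inj ->]; rewrite ?addr0 ?add0r.
rewrite [X in _ + X]exchange_big /= -big_split /=.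
under eq_bigr => a _ do rewrite -big_split /=.
rewrite pair_bigA [RHS]big_mkcond; apply: eq_bigr => -[a b] _ /=.
by rewrite inE /=; case: ifP; rewrite ?addr0.
Qed.

(* The indicators of [s a = x] for these [(a, x)] span, together with the affine
   functions of the [s a], all the indicators of [s a = x]: the values [0] and
   [n - 1] are reached by interpolation, the last position by summing over [a]. *)
Definition inner_points k : {set 'I_k.+2 * 'I_k.+2} :=
  finset.setX [set~ ord_max] (~: [set ord0; ord_max]).

Lemma in_inner_points k p : (p \in inner_points k) =
  [&& p.1 != ord_max, p.2 != ord0 & p.2 != ord_max].
Proof. by case: p => a x; rewrite !inE negb_or. Qed.

Lemma sum_inner_points (R : nmodType) k (G : 'I_k.+2 -> 'I_k.+2 -> R) :
  \sum_(p in inner_points k) G p.1 p.2 =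
  \sum_(a | a != ord_max) \sum_(x | (x != ord0) && (x != ord_max)) G a x.
Proof. by rewrite pair_big; apply: eq_bigl => p; rewrite in_inner_points. Qed.

Lemma card_inner_points k : #|inner_points k| = (k.+1 * k)%N.
Proof.
rewrite cardsX cardsC1 card_ord; congr (_ * _)%N.
by have := cardsC [set ord0; ord_max : 'I_k.+2]; rewrite cards2 card_ord => -[].
Qed.

(** Subtracting from [g] the affine function that agrees with it at both ends leaves a function
    supported on the inner values. *)
Lemma affine_interpolation (R : numFieldType) k (g : 'I_k.+2 -> R) y
    (beta := (g ord_max - g ord0) / k.+1%:R) :
  g y = g ord0 + beta * y%:R +
    \sum_(x | (x != ord0) && (x != ord_max))
      (y == x)%:R * (g x - g ord0 - beta * x%:R).
Proof.
have kn0 : k.+1%:R != 0 :> R by rewrite pnatr_eq0.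
have sum0 : ~~ ((y != ord0) && (y != ord_max)) ->
    \sum_(x | (x != ord0) && (x != ord_max))
      (y == x)%:R * (g x - g ord0 - beta * x%:R) = 0.
  move=> yP; rewrite big1 // => x xP; case: eqP => [yx|]; last by rewrite mul0r.
  by rewrite yx xP in yP.
case: (eqVneq y ord0) sum0 => [->|y0] sum0.
  by rewrite sum0 ?eqxx //= mulr0 !addr0.
case: (eqVneq y ord_max) sum0 => [->|ym] sum0.
  by rewrite sum0 ?eqxx ?andbF //= /beta divfK // addr0 addrC subrK.
rewrite (bigD1 y) ?y0 //= eqxx big1 => [|x /andP[_ xy]] /=; first by ring.
by rewrite eq_sym (negbTE xy) mul0r.
Qed.

Lemma mif_mulV (R : comNzRingType) n (t s : 'S_n) :
  mif R (t^-1 * s)%g =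
  \sum_a \sum_b maj_inv_weight R (t a) (t b) * (s b < s a)%N%:R + \sum_a (s a == t a)%:R.
Proof. by rewrite /mif wdes_mulV nfix_mulV natr_sum. Qed.

(** The matrix splits as [h1 + h2 + h3]: a part constant in [s], one comparison for each pair, and
    one indicator for each inner point. The slopes [be] of the interpolated indicators are absorbed
    into [v], as [s a] is a sum of comparisons. *)
Lemma rank_conv_mif (R : realFieldType) k :
  (\rank (conv_mx (mif R (n := k.+2))) <=
     1 + 'C(k.+2, 2) + #|inner_points k|)%N.
Proof.
pose X (x : 'I_k.+2) := (x != ord0) && (x != ord_max).
pose g (t : 'S_k.+2) a y : R := (y == t a)%:R.
pose be t a := (g t a ord_max - g t a ord0) / k.+1%:R.
pose ga t a x := g t a x - g t a ord0 - be t a * x%:R.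
pose v (t : 'S_k.+2) a b : R := maj_inv_weight R (t a) (t b) + be t a.
pose h1 (t s : 'S_k.+2) := \sum_a g t a ord0 + \sum_(x | X x) ga t ord_max x +
   \sum_(p in lt_pairs k.+2) v t p.2 p.1.
pose h2 (t s : 'S_k.+2) := \sum_(p in lt_pairs k.+2)
  (v t p.1 p.2 - v t p.2 p.1) * (s p.2 < s p.1)%N%:R.
pose h3 (t s : 'S_k.+2) := \sum_(p in inner_points k)
  (ga t p.1 p.2 - ga t ord_max p.2) * (s p.1 == p.2)%:R.
have gE (t s : 'S_k.+2) : \sum_a (s a == t a)%:R = \sum_a g t a ord0 +
    \sum_a \sum_b be t a * (s b < s a)%N%:R + \sum_(x | X x) ga t ord_max x + h3 t s.
  transitivity (\sum_a (g t a ord0 + be t a * (s a)%:R +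
      \sum_(x | X x) (s a == x)%:R * ga t a x)).
    by apply: eq_bigr => a _; apply: (affine_interpolation (g t a)).
  rewrite [LHS]big_split [X in X + _ = _]big_split /= -[RHS]addrA; congr (_ + _ + _).
    by apply: eq_bigr => a _; rewrite -mulr_sumr sum_ltn_perm.
  rewrite /h3 (sum_inner_points (fun a x => (ga t a x - ga t ord_max x) * (s a == x)%:R)).
  rewrite [LHS]exchange_big [X in _ = _ + X]exchange_big -big_split; apply: eq_bigr => x _ /=.
  (* The last position is eliminated through [\sum_a (s a == x) = 1], which leaves [ga t ord_max x]
     as a constant. *)
  transitivity (\sum_a ((ga t a x - ga t ord_max x) * (s a == x)%:R +
                        (s a == x)%:R * ga t ord_max x)).
    by apply: eq_bigr => a _; ring.
  rewrite big_split /= addrC -mulr_suml (sum_perm_image s (fun y => (y == x)%:R)).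
  rewrite [X in X * _](bigD1 x) //= eqxx [X in (1 + X) * _]big1 => [|y /negbTE -> //].
  rewrite addr0 mul1r; congr (_ + _).
  by rewrite (bigD1 ord_max) //= subrr mul0r add0r.
(* The comparisons for [(a, b)] and [(b, a)] add up to 1, so one for each pair suffices, up to a
   term constant in [s]. *)
have vE (t s : 'S_k.+2) : \sum_a \sum_b v t a b * (s b < s a)%N%:R =
    \sum_(p in lt_pairs k.+2) v t p.2 p.1 + h2 t s.
  rewrite sum_lt_pairs => [|a]; last by rewrite ltnn mulr0.
  rewrite -big_split; apply: eq_bigr => -[a b]; rewrite inE /= => ab.
  case: (ltngtP (s b) (s a)) => [_|_|/val_inj/perm_inj ba] /=; [ring|ring|].
  by rewrite ba ltnn in ab.
have -> : conv_mx (mif R (n := k.+2)) =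
    \matrix_(i, j) h1 (enum_val i) (enum_val j) +
    \matrix_(i, j) h2 (enum_val i) (enum_val j) +
    \matrix_(i, j) h3 (enum_val i) (enum_val j).
  apply/matrixP => i j; rewrite !mxE mif_mulV gE.
  set t := enum_val i; set s := enum_val j.
  have := vE t s; rewrite /v; under eq_bigr => a _ do under eq_bigr => b _ do rewrite mulrDl.
  under eq_bigr => a _ do rewrite big_split /=.
  rewrite big_split /= => e.
  have {}e := canRL (addrK _) e; rewrite e /h1 /v; ring.
apply: leq_trans (mxrank_add _ _) _; apply: leq_add.
  apply: leq_trans (mxrank_add _ _) _; apply: leq_add.
    rewrite -[X in (_ <= X)%N](cards1 tt).
    (* As [h1 t s] does not depend on [s], it may be evaluated at the identity. *)
    apply: (rank_span_family (K := fun _ _ => 1) (c := fun t _ => h1 t 1%g)) => t s.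
    by rewrite big_set1 mulr1.
  rewrite -(card_ltn_pairs (leqnn _)).
  have <- : lt_pairs k.+2 = [set p : 'I_k.+2 * 'I_k.+2 | (p.1 < p.2 < k.+2)%N].
    by apply/setP => p; rewrite !inE ltn_ord andbT.
  exact: (rank_span_family (K := fun p s => (s p.2 < s p.1)%N%:R)
    (c := fun t p => v t p.1 p.2 - v t p.2 p.1)).
exact: (rank_span_family (K := fun p s => (s p.1 == p.2)%:R)
  (c := fun t p => ga t p.1 p.2 - ga t ord_max p.2)).
Qed.

(** * Lower bounds on the eigenspaces *)

Lemma rank_eigenspace_const (R : numFieldType) k :
  (1 <= \rank (eigenspace (conv_mx (mif R (n := k.+2)))
     (k.+2`!%:R * 'C(k.+2, 2)%:R + k.+2`!%:R)))%N.
Proof.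
rewrite -[X in (X <= _)%N](cards1 tt).
apply: (rank_eigenspace_family (K := fun _ _ => 1)) => [_ s _|c c0 [] _].
  by rewrite convol_mif1 mulr1.
by have := c0 1%g; rewrite big_set1 mulr1.
Qed.

(** For [a != ord_max] these form a basis of the functions with sum zero. *)
Definition delta_diff (R : nzRingType) k (a d : 'I_k.+2) : R :=
  (d == a)%:R - (d == ord_max)%:R.

Lemma sum_delta_diff (R : nzRingType) k (a : 'I_k.+2) : \sum_d delta_diff R a d = 0.
Proof.
have one (b : 'I_k.+2) : \sum_d (d == b)%:R = 1 :> R.
  by rewrite (bigD1 b) //= eqxx big1 ?addr0 // => d /negbTE ->.
by rewrite sumrB !one subrr.
Qed.

(** The combined coefficients [Psi] satisfy the hypotheses of [point_indep], hence vanish; by the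
    duality of [phi] with the second coordinates, the entry of [Psi] at [p] is [c p]. *)
Lemma delta_diff_family_free (R : numFieldType) k (A : {set 'I_k.+2 * 'I_k.+2})
    (phi : 'I_k.+2 -> 'I_k.+2 -> R) x0 (c : 'I_k.+2 * 'I_k.+2 -> R) :
  (forall p, p \in A -> p.1 != ord_max) ->
  (forall p, p \in A -> phi p.2 x0 = 0) ->
  (forall p q, p \in A -> q \in A -> phi q.2 p.2 = (q.2 == p.2)%:R) ->
  (forall s : 'S_k.+2,
     \sum_(p in A) c p * \sum_d delta_diff R p.1 d * phi p.2 (s d) = 0) ->
  forall p, p \in A -> c p = 0.
Proof.
move=> Amax phi0 phiA c0 p pA.
pose Psi d y := \sum_(q in A) c q * (delta_diff R q.1 d * phi q.2 y).
have := @point_indep R _ Psi x0 _ _ _ p.1 p.2; rewrite /Psi (bigD1 p) //= big1.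
  move=> <-; rewrite ?addr0.
  - by rewrite phiA // /delta_diff eqxx (negbTE (Amax _ pA)) eqxx /=; ring.
  - move=> s; rewrite exchange_big -[RHS](c0 s); apply: eq_bigr => q _ /=.
    by rewrite mulr_sumr.
  - move=> x; rewrite exchange_big big1 // => q _.
    by rewrite -mulr_sumr -mulr_suml sum_delta_diff mul0r mulr0.
  - by move=> d; rewrite big1 // => q /phi0 ->; rewrite !mulr0.
move=> q /andP[qA qp]; rewrite phiA // /delta_diff (negbTE (Amax _ pA)) subr0.
case: eqP => [e1|_] /=; last by rewrite mul0r mulr0.
case: eqP => [e2|_] /=; last by rewrite !mulr0.
by case/eqP: qp; case: q e1 e2 {qA} => ? ? /= <- ->; case: p {pA}.
Qed.

Lemma rank_eigenspace_linear (R : numFieldType) k : (0 < k)%N ->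
  (k.+1 <= \rank (eigenspace (conv_mx (mif R (n := k.+2)))
     (k.+2%:R * (2 - k.+2%:R) * (k.+2%:R + 5) * (k`!%:R / 6))))%N.
Proof.
(* The second coordinate is frozen at the value 1, where the identity function equals 1; it vanishes
   at [x0 = ord0], as the freeness lemma demands. *)
move=> k0; pose A := finset.setX [set~ ord_max : 'I_k.+2] [set lift ord0 ord0 : 'I_k.+2].
have cA : #|A| = k.+1 by rewrite cardsX cardsC1 cards1 card_ord muln1.
rewrite -[X in (X <= _)%N]cA.
apply: (rank_eigenspace_family
  (K := fun p s => \sum_d delta_diff R p.1 d * (s d)%:R)) => [p s _|c c0].
  rewrite (convol_mif_point (fun y => y%:R)) ?sum_delta_diff //.
  have -> : \sum_(x < k.+2) \sum_(y < k.+2) maj_inv_weight R x y * (x%:R - y%:R) =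
      - (k.+2%:R * (k.+2%:R - 1) * (k.+2%:R + 4) / 6).
    rewrite -sum_maj_inv_weight_diff -sumrN; apply: eq_bigr => x _; rewrite -sumrN.
    by apply: eq_bigr => y _; ring.
  (* With [n = k + 2], this rests on [6 - (n - 1) * (n + 4) = (2 - n) * (n + 5)]. *)
  by field.
apply: (delta_diff_family_free (phi := fun _ y => y%:R) (x0 := ord0)) c0 => //.
- by move=> [a x]; rewrite !inE => /andP[].
- move=> [a x] [b y]; rewrite !inE /= => /andP[_ /eqP ->] /andP[_ /eqP ->].
  by rewrite eqxx.
Qed.

Definition weight_form (R : nzRingType) n (phi : 'I_n -> R) : R :=
  \sum_x \sum_y maj_inv_weight R x y * (phi x - phi y).

(** The weights are nonnegative and live on [x < y], where the difference of indicators is 1 if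
    [x = 0] and 0 otherwise; the pair (0, 1) has weight 2. *)
Lemma weight_form_delta0 (R : realFieldType) k :
  weight_form (fun y : 'I_k.+2 => (y == ord0)%:R : R) != 0.
Proof.
have maj_inv_weight_ge0 (x y : 'I_k.+2) : 0 <= maj_inv_weight R x y by rewrite addr_ge0 ?mulr_ge0.
apply: lt0r_neq0; rewrite /weight_form (bigD1 ord0) //= ltr_pwDl //.
  rewrite (bigD1 (lift ord0 ord0)) //= ltr_pwDl //.
    by rewrite /maj_inv_weight /= !mulr1 subr0 mulr1; apply: ltr_pwDl.
  by apply: sumr_ge0 => y _; case: (eqVneq y ord0) => [->|_] /=;
    rewrite ?subrr ?subr0 ?mulr0 ?mulr1.
apply: sumr_ge0 => x /negbTE x0; apply: sumr_ge0 => y _; rewrite x0.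
case: (eqVneq y ord0) => [->|_]; last by rewrite subrr mulr0.
by rewrite maj_inv_weight_eq0 // mul0r.
Qed.

Lemma rank_eigenspace_point (R : realFieldType) k : (0 < k)%N ->
  (#|inner_points k| <= \rank (eigenspace (conv_mx (mif R (n := k.+2)))
     (k.+2%:R * k`!%:R)))%N.
Proof.
move=> k0; pose de (z y : 'I_k.+2) : R := (y == z)%:R.
(* The indicator of [z] is moved into the kernel of [weight_form] by a multiple of the indicator of
   [ord0], which changes neither the inner values nor the one at [ord_max]. *)
pose phi z y := de z y - weight_form (de z) / weight_form (de ord0) * de ord0 y.
have phi0 z : \sum_x \sum_y maj_inv_weight R x y * (phi z x - phi z y) = 0.
  have -> : \sum_x \sum_y maj_inv_weight R x y * (phi z x - phi z y) =
      weight_form (de z) - weight_form (de z) / weight_form (de ord0) * weight_form (de ord0).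
    rewrite {1 4}/weight_form mulr_sumr -sumrB; apply: eq_bigr => x _.
    by rewrite mulr_sumr -sumrB; apply: eq_bigr => y _; rewrite /phi; ring.
  by rewrite divfK ?weight_form_delta0 // subrr.
apply: (rank_eigenspace_family
  (K := fun p s => \sum_d delta_diff R p.1 d * phi p.2 (s d))) => [p s _|c c0].
  by rewrite convol_mif_point ?sum_delta_diff // phi0 mulr0 mul0r addr0.
apply: (delta_diff_family_free (phi := phi) (x0 := ord_max)) c0.
- by move=> p; rewrite in_inner_points => /and3P[].
- move=> p; rewrite in_inner_points => /and3P[_ _ /negbTE pm].
  by rewrite /phi /de eq_sym pm /= mulr0 subr0.
- move=> p q; rewrite !in_inner_points => /and3P[_ /negbTE p0 _] _.
  by rewrite /phi /de p0 mulr0 subr0 eq_sym.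
Qed.

Lemma rank_eigenspace_skew (R : numFieldType) k : (0 < k)%N ->
  ('C(k.+1, 2) <= \rank (eigenspace (conv_mx (mif R (n := k.+2)))
     (- (2 * k.+2`!%:R / 3))))%N.
Proof.
move=> k0; rewrite -(card_ltn_pairs (leqnSn k.+1)).
set A := [set p | _].
pose e2 (a b d e : 'I_k.+2) : R := (d == a)%:R * (e == b)%:R - (d == b)%:R * (e == a)%:R.
(* The circulation around the oriented triangle [p.1], [p.2], [ord_max]: its row sums vanish. Among
   the triangles from [A], it alone uses the edge [(p.1, p.2)], so that entry of [C] is [c p]. *)
pose cy (p : 'I_k.+2 * 'I_k.+2) d e :=
  e2 p.1 p.2 d e + e2 p.2 ord_max d e + e2 ord_max p.1 d e.
have cyN p d e : cy p e d = - cy p d e by rewrite /cy /e2; ring.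
have cy0 p d : \sum_e cy p d e = 0.
  have one (b : 'I_k.+2) : \sum_e (e == b)%:R = 1 :> R.
    by rewrite (bigD1 b) //= eqxx big1 ?addr0 // => f /negbTE ->.
  have e20 a b : \sum_e e2 a b d e = (d == a)%:R - (d == b)%:R.
    by rewrite /e2 sumrB -!mulr_sumr !one !mulr1.
  by rewrite /cy big_split [X in X + _ = _]big_split /= !e20; ring.
apply: (rank_eigenspace_family
  (K := fun p s => \sum_d \sum_e cy p d e * (s d < s e)%N%:R)) => [p s _|c c0 p pA].
  exact: convol_mif_skew.
pose C d e := \sum_(q in A) c q * cy q d e.
have CN d e : C e d = - C d e.
  by rewrite /C -sumrN; apply: eq_bigr => q _; rewrite cyN mulrN.
have := @skew_indep R k C CN _ p.1 p.2; rewrite {2}/C (bigD1 p) //= big1.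
  move=> <-; rewrite ?addr0.
    move: pA; rewrite inE => /andP[p12 p2]; rewrite /cy /e2 !eqxx.
    have -> : p.2 == p.1 = false by rewrite -val_eqE gtn_eqF.
    have -> : p.1 == p.2 = false by rewrite -val_eqE ltn_eqF.
    have -> : p.1 == ord_max = false by rewrite -val_eqE ltn_eqF // (ltn_trans p12).
    have -> : p.2 == ord_max = false by rewrite -val_eqE ltn_eqF.
    by rewrite /=; ring.
  move=> s; rewrite -[RHS](c0 s) /C.
  under eq_bigr => d _ do under eq_bigr => e _ do rewrite mulr_suml.
  under eq_bigr => d _ do rewrite exchange_big /=.
  rewrite exchange_big; apply: eq_bigr => q _ /=; rewrite mulr_sumr.
  by apply: eq_bigr => d _; rewrite mulr_sumr; apply: eq_bigr => e _; rewrite mulrA.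
move=> q /andP[qA qp]; move: pA qA; rewrite !inE => /andP[p12 p2] /andP[q12 q2].
have -> : cy q p.1 p.2 = 0; last by rewrite mulr0.
rewrite /cy /e2.
have -> : p.1 == ord_max = false by rewrite -val_eqE ltn_eqF // (ltn_trans p12).
have -> : p.2 == ord_max = false by rewrite -val_eqE ltn_eqF.
have -> : (p.1 == q.1)%:R * (p.2 == q.2)%:R = 0 :> R.
  case: eqP => [e1|_]; last by rewrite mul0r.
  case: eqP => [e2'|_]; last by rewrite mulr0.
  by case/eqP: qp; case: q e1 e2' {q12 q2} => ? ? /= <- <-; case: p {p12 p2}.
have -> : (p.1 == q.2)%:R * (p.2 == q.1)%:R = 0 :> R.
  case: eqP => [e1|_]; last by rewrite mul0r.
  case: eqP => [e2'|_]; last by rewrite mulr0.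
  by move: p12; rewrite e1 e2' ltnNge ltnW.
by rewrite /=; ring.
Qed.

(** * Spectrum and multiplicities of [Mif] *)

Lemma Mif_conv (R : realType) n : (Mif R n)^T = conv_mx (mif R (n := n)).
Proof.
apply/matrixP => i j; rewrite !mxE; set st := (_ * _)%g.
by rewrite /mif -maj_inv_wdes -natrD.
Qed.

Theorem corollary1p3 (R : realType) (n : nat) (hn : (4 <= n)%N) :
  let M := Mif R n in
  let l1 : R := n`!%:R * 'C(n, 2)%:R + n`!%:R in
  let l2 : R := n%:R * (2 - n%:R) * (n%:R + 5) * ((n - 2)`!%:R / 6) in
  let l3 : R := - (2 * n`!%:R / 3) in
  let l4 : R := n%:R * (n - 2)`!%:R in
  [/\ diagonalizable M,
      Sp M = [set l1; l2; l3; l4; 0]%classic &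
      [/\ mult M l1 = 1%N,
          mult M l2 = (n - 1)%N,
          mult M l3 = 'C(n - 1, 2),
          mult M l4 = ((n - 1) * (n - 2))%N &
          (mult M 0)%:R = n`!%:R - n%:R / 2 * (3 * n%:R - 7) - 3 :> R]].
Proof.
case: n hn => [|[|k]] // hn M; rewrite !subSS !subn0 => l1 l2 l3 l4.
have {hn} k2 : (1 < k)%N by [].
have k0 : (0 < k)%N by exact: ltnW.
(* The sum of the four multiplicities for nonzero eigenvalues, which is also the bound on the
   rank. *)
pose r := (1 + k.+1 + 'C(k.+1, 2) + k.+1 * k)%N.
have rkE : r = (1 + 'C(k.+2, 2) + #|inner_points k|)%N.
  by rewrite card_inner_points /r [in RHS]binS bin1; lia.
have C2 m : 'C(m.+1, 2)%:R = (m%:R + 1) * m%:R / 2 :> R.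
  by rewrite -bin2_sum big_mkord natr_sum sum_ord_natr -natr1; field.
have kR : 2 <= k%:R :> R by rewrite ler_nat.
have fR : 2 <= k`!%:R :> R.
  by rewrite ler_nat; case: (k) k2 => [|[|m]] // _; rewrite (leq_trans _ (fact_geq _)).
have rR : r%:R = 1 + (k%:R + 1) + (k%:R + 1) * k%:R / 2 + (k%:R + 1) * k%:R :> R.
  by rewrite /r natrD natrM natrD C2 natrD -natr1; ring.
(* Makes 0 an eigenvalue. For [k = 1] both sides would be 6; [k >= 2] gives [2 <= k!], which
   suffices. *)
have rlt : (r < k.+2`!)%N.
  rewrite -(ltr_nat R) rR 2!factS !natrM -[k.+2%:R]natr1 -[k.+1%:R]natr1.
  have : (k%:R + 1 + 1) * ((k%:R + 1) * 2) <= (k%:R + 1 + 1) * ((k%:R + 1) * k`!%:R) :> R.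
    by rewrite !ler_wpM2l //; lra.
  move=> h; apply: (lt_le_trans _ h); nra.
pose ls : seq R := [:: l1; l2; l3; l4; 0].
pose ds := [:: 1; k.+1; 'C(k.+1, 2); k.+1 * k; k.+2`! - r]%N.
have lsU : uniq ls.
  have P0 : 0 < (k%:R + 2) * k`!%:R :> R by apply: mulr_gt0; lra.
  have E1 : l1 = (k%:R + 2) * k`!%:R * ((k%:R + 1) * ((k%:R + 2) * (k%:R + 1) / 2 + 1)).
    by rewrite /l1 C2 2!factS !natrM -[k.+2%:R]natr1 -[k.+1%:R]natr1; field.
  have E2 : l2 = (k%:R + 2) * k`!%:R * - (k%:R * (k%:R + 7) / 6).
    by rewrite /l2 -[k.+2%:R]natr1 -[k.+1%:R]natr1; field.
  have E3 : l3 = (k%:R + 2) * k`!%:R * - (2 * (k%:R + 1) / 3).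
    by rewrite /l3 2!factS !natrM -[k.+2%:R]natr1 -[k.+1%:R]natr1; field.
  have E4 : l4 = (k%:R + 2) * k`!%:R.
    by rewrite /l4 -[k.+2%:R]natr1 -[k.+1%:R]natr1; ring.
  (* This amounts to [(k - 1) * (k + 4) > 0], hence needs [k > 1]. The order is
     [l2 < l3 < 0 < l4 < l1]. *)
  have l23 : l2 < l3 by rewrite E2 E3 ltr_pM2l //; nra.
  have l30 : l3 < 0 by rewrite E3 pmulr_rlt0 //; lra.
  have l40 : 0 < l4 by rewrite E4.
  have l14 : l4 < l1 by rewrite E1 E4 ltr_pMr //; nra.
  rewrite /ls /= !inE !negb_or !andbT.
  by repeat (apply/andP; split); apply/eqP; lra.
have rk (i : 'I_5) : (nth 0%N ds i <= \rank (eigenspace M^T (nth 0%R ls i)))%N.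
  rewrite Mif_conv; case: i => -[|[|[|[|[|//]]]]] _ /=.
  - exact: rank_eigenspace_const.
  - exact: rank_eigenspace_linear.
  - exact: rank_eigenspace_skew.
  - by rewrite -card_inner_points; apply: rank_eigenspace_point.
  (* The eigenspace of 0 is the kernel, so the rank bound gives its dimension from below. *)
  - rewrite /eigenspace mxrank_ker raddf0 subr0.
    by rewrite -[X in (X - _ <= _)%N]card_Sn leq_sub2l // rkE rank_conv_mif.
have dsN : (\sum_(i < 5) nth 0 ds i = #|{: 'S_k.+2}|)%N.
  by rewrite card_Sn !big_ord_recl big_ord0 /=; lia.
have [|Mdiag Mmup Meig] := diagonalizable_of_rank_eigenspace _ rk dsN.
  by move=> i j /eqP; rewrite nth_uniq // => /eqP /val_inj.
rewrite char_poly_trmx in Mmup.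
have mE i (i5 : (i < 5)%N) : mult M (nth 0%R ls i) = nth 0%N ds i.
  exact: (Mmup (Ordinal i5)).
have eigM x : eigenvalue M x = eigenvalue M^T x.
  by rewrite !eigenvalue_root_char char_poly_trmx.
have eig i : (i < 5)%N -> eigenvalue M (nth 0%R ls i).
  move=> i5; rewrite eigM /eigenvalue -mxrank_eq0 -lt0n.
  apply: leq_trans (rk (Ordinal i5)).
  case: i i5 => [|[|[|[|[|//]]]]] _ //=; rewrite ?bin_gt0 ?muln_gt0 ?k0 ?subn_gt0 //.
split; first exact: diagonalizable_trmx.
- apply/seteqP; split=> x /=.
    rewrite /Sp /= eigM => /Meig [[[|[|[|[|[|//]]]]] i5] /= ->].
    + by left; left; left; left.
    + by left; left; left; right.
    + by left; left; right.
    + by left; right.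
    + by right.
  move=> [[[[|]|]|]|] ->.
  + exact: (eig 0%N).
  + exact: (eig 1%N).
  + exact: (eig 2%N).
  + exact: (eig 3%N).
  + exact: (eig 4%N).
- split; rewrite ?(mE 0%N) ?(mE 1%N) ?(mE 2%N) ?(mE 3%N) //.
  by rewrite (mE 4%N) //= natrB ?(ltnW rlt) // rR -[k.+2%:R]natr1 -[k.+1%:R]natr1; field.
Qed.
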